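(* Let $\nu:\mathcal X\subset\mathbb R^{n_x}\to\mathbb R^{n_y}$ be an ELLC constraint/observation function, $\nu(x)=\mu(x,u)$ with $u$ known, with known Clarke-derivative bounds $a_{pq},b_{pq}$; let $[\underline y,\overline y]\subset\mathbb R^{n_y}$ be an interval containing the constraint/observation set $\mathcal Y$, and let $\mathbb I\mathcal X^p=[\underline x^p,\overline x^p]\subset\mathcal X$ be a prior/propagated interval. Then, for any threshold $\epsilon>0$, the interval $\mathbb I\mathcal X^u=[\underline x^u,\overline x^u]$ returned by the set inversion algorithm SET-INV of the context satisfies $$\{x\in\mathbb I\mathcal X^p:\ \mu(x,u)\in[\underline y,\overline y]\}\subseteq\mathbb I\mathcal X^u\subseteq\mathbb I\mathcal X^p.$$
   Context: Notation: $\mathbb N_n=\{1,\dots,n\}$; vector inequalities $\le$ are componentwise; $[\underline x,\overline x]=\{x:\underline x\le x\le\overline x\}$. $\mathcal X$ is a box; topological notions are relative to $\mathcal X$. ELLC: $\varphi:\mathcal X\to\mathbb R$ is either-sided locally Lipschitz continuous if for every $x\in\mathcal X$ there are an open neighborhood $\mathcal N_x$ of $x$, a vector $\kappa\in\mathbb R^{n_x}$ with all entries nonzero, and $\rho\in\mathbb R$ such that $\langle\kappa(\varphi(x')-\varphi(x'')),x'-x''\rangle\le\rho\|x'-x''\|_2^2$ for all $x',x''\in\mathcal N_x$; a vector function is ELLC if each component is. Clarke-derivative bounds: $a_{pq}\in\mathbb R\cup\{-\infty\}$, $b_{pq}\in\mathbb R\cup\{+\infty\}$, not both infinite for any $(p,q)$,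 with $a_{pq}\le\liminf_{t\to x,\lambda\downarrow0}\frac{\nu_p(t+\lambda e_q)-\nu_p(t)}{\lambda}$ and $\limsup_{t\to x,\lambda\downarrow0}\frac{\nu_p(t+\lambda e_q)-\nu_p(t)}{\lambda}\le b_{pq}$ for all $x\in\mathcal X$, $p\in\mathbb N_{n_y}$, $q\in\mathbb N_{n_x}$ ($e_q$ the standard unit vectors). Bounding function: for $\underline\xi\le\overline\xi$ in $\mathcal X$ and each $p$, let $\mathbf M_p^c=\{\mathbf m\in\mathbb R^{n_x}:\forall q,\ \mathbf m_q=\max(b_{pq},0)\text{ or }\mathbf m_q=\min(a_{pq},0)\}$. For $\mathbf m\in\mathbf M_p^c$ let $(\zeta^+_{\mathbf m,q},\zeta^-_{\mathbf m,q})=(\overline\xi_q,\underline\xi_q)$ if $\mathbf m_q=\min(a_{pq},0)$ and $(\underline\xi_q,\overline\xi_q)$ otherwise. Define $T_R^{\nu_d}(\underline\xi,\overline\xi)=(\overline\nu_d,\underline\nu_d)$ with $\overline\nu_{d,p}=\min_{\mathbf m\in\mathbf M_p^c}\nu_p(\zeta^+_{\mathbf m})+\mathbf m^\top(\zeta^-_{\mathbf m}-\zeta^+_{\mathbf m})$ and $\underline\nu_{d,p}=\max_{\mathbf m\in\mathbf M_p^c}\nu_p(\zeta^-_{\mathbf m})+\mathbf m^\top(\zeta^+_{\mathbf m}-\zeta^-_{\mathbf m})$. Algorithm SET-INV$(\nu,\underline x^p,\overline x^p,\underline y,\overline y,\epsilon)$: initialize $\overline x^u\leftarrow\overline x^p$,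 $\underline x^u\leftarrow\underline x^p$. For $i=1,\dots,n_x$ do the following two loops. (A) Set $\underline\zeta\leftarrow\underline x_i^u$, $\overline\zeta\leftarrow\overline x_i^u$. While $\overline\zeta-\underline\zeta>\epsilon$: put $\zeta_m\leftarrow\frac12(\underline\zeta+\overline\zeta)$, $\overline\xi\leftarrow\overline x^u$, $\underline\xi\leftarrow\underline x^u$, $\underline\xi_i\leftarrow\zeta_m$; compute $(\overline\nu_d,\underline\nu_d)=T_R^{\nu_d}(\underline\xi,\overline\xi)$; if for some $p$, $\overline\nu_{d,p}<\underline y_p$ or $\underline\nu_{d,p}>\overline y_p$, then $\overline\zeta\leftarrow\zeta_m$ and $\overline x_i^u\leftarrow\overline\zeta$; else $\underline\zeta\leftarrow\zeta_m$. (B) Set $\underline\zeta\leftarrow\underline x_i^u$, $\overline\zeta\leftarrow\overline x_i^u$. While $\overline\zeta-\underline\zeta>\epsilon$: put $\zeta_m\leftarrow\frac12(\underline\zeta+\overline\zeta)$, $\overline\xi\leftarrow\overline x^u$, $\underline\xi\leftarrow\underline x^u$, $\overline\xi_i\leftarrow\zeta_m$; compute $(\overline\nu_d,\underline\nu_d)=T_R^{\nu_d}(\underline\xi,\overline\xi)$; if for some $p$, $\overline\nu_{d,p}<\underline y_p$ or $\underline\nu_{d,p}>\overline y_p$, then $\underline\zeta\leftarrow\zeta_m$ and $\underline x_i^u\leftarrow\underline\zeta$; else $\overline\zeta\leftarrow\zeta_m$. Return $\overline x^u,\underline x^u$. *)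

(* Defs.v *)
From mathcomp Require Import all_boot all_order all_algebra.
From mathcomp Require Import all_classical all_reals all_analysis.

Set Implicit Arguments.
Unset Strict Implicit.
Unset Printing Implicit Defensive.

Import Order.TTheory GRing.Theory Num.Theory.
Import numFieldNormedType.Exports.

Local Open Scope classical_set_scope.
Local Open Scope ring_scope.

Section Vectors.
Context {R : realType} {n : nat}.
Implicit Types (x y : 'rV[R]_n) (q : 'I_n).

Definition dot x y : R := \sum_q x 0 q * y 0 q.

(* The library's norm on matrices is the sup norm. *)
Definition norm2 x : R := Num.sqrt (dot x x).

Definition box_between (lo hi : 'rV[R]_n) : set 'rV[R]_n :=
  [set x | forall q, lo 0 q <= x 0 q /\ x 0 q <= hi 0 q].

(* A box is any product of n intervals; each factor may be open, closed,
   half-open or unbounded. *)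
Definition is_box (X : set 'rV[R]_n) : Prop :=
  exists I : 'I_n -> interval R, X = [set x | forall q, x 0 q \in I q].

Definition unit_vec q : 'rV[R]_n := delta_mx 0 q.

Definition set_coord x q (c : R) : 'rV[R]_n :=
  \row_k (if k == q then c else x 0 k).

End Vectors.

(* Functions on X are total functions of which only the values on X matter;
   [N `&` X], for N open, is an open set of the subspace X. *)
Definition ELLC {R : realType} {n : nat} (X : set 'rV[R]_n)
    (phi : 'rV[R]_n -> R) : Prop :=
  forall x, X x ->
    exists (N : set 'rV[R]_n) (kappa : 'rV[R]_n) (rho : R),
      [/\ open N, N x, (forall q, kappa 0 q != 0) &
          forall x' x'', (N `&` X) x' -> (N `&` X) x'' ->
            dot ((phi x' - phi x'') *: kappa) (x' - x'')
              <= rho * norm2 (x' - x'') ^+ 2].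

Definition ELLC_vec {R : realType} {n m : nat} (X : set 'rV[R]_n)
    (nu : 'rV[R]_n -> 'rV[R]_m) : Prop :=
  forall p, ELLC X (fun x => nu x 0 p).

Section ClarkeBounds.
Context {R : realType} {n m : nat}.
Variables (X : set 'rV[R]_n) (nu : 'rV[R]_n -> 'rV[R]_m).

(* The filter "t -> x, l decreases to 0" on pairs (t, l), restricted to those
   for which the difference quotient only evaluates nu on X. *)
Definition clarke_filter (x : 'rV[R]_n) (q : 'I_n) :
    set_system ('rV[R]_n * R) :=
  within [set tl | X tl.1 /\ X (tl.1 + tl.2 *: unit_vec q)]
    (filter_prod (nbhs x) (0 : R)^'+).

Definition diff_quotient (p : 'I_m) (q : 'I_n) (tl : 'rV[R]_n * R) : \bar R :=
  ((nu (tl.1 + tl.2 *: unit_vec q) 0 p - nu tl.1 0 p) / tl.2)%:E.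

Definition clarke_bounds (a b : 'I_m -> 'I_n -> \bar R) : Prop :=
  forall p q,
    [/\ a p q != +oo%E,
        b p q != -oo%E,
        ~ (a p q = -oo%E /\ b p q = +oo%E) &
        forall x, X x ->
          (a p q <= limf_einf (diff_quotient p q) (clarke_filter x q))%E /\
          (limf_esup (diff_quotient p q) (clarke_filter x q) <= b p q)%E].

End ClarkeBounds.

(* Least and greatest elements; they are only applied to the nonempty finite
   sets of values indexed by [Mc] below. *)
Definition set_min {R : realType} (A : set R) : R :=
  get [set v | A v /\ lbound A v].

Definition set_max {R : realType} (A : set R) : R :=
  get [set v | A v /\ ubound A v].

Section BoundingFunction.
Context {R : realType} {n m : nat}.
Variables (nu : 'rV[R]_n -> 'rV[R]_m) (a b : 'I_m -> 'I_n -> \bar R).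

(* Entries of M are real, so an infinite max(b,0) or min(a,0) is never
   selected. *)
Definition Mc (p : 'I_m) : set 'rV[R]_n :=
  [set M | forall q, (M 0 q)%:E = maxe (b p q) 0 \/
                     (M 0 q)%:E = mine (a p q) 0].

Section Corners.
Variables (xilo xihi : 'rV[R]_n) (p : 'I_m) (M : 'rV[R]_n).

Definition zeta_plus : 'rV[R]_n :=
  \row_q (if (M 0 q)%:E == mine (a p q) 0 then xihi 0 q else xilo 0 q).

Definition zeta_minus : 'rV[R]_n :=
  \row_q (if (M 0 q)%:E == mine (a p q) 0 then xilo 0 q else xihi 0 q).

End Corners.

Definition nu_upper (xilo xihi : 'rV[R]_n) (p : 'I_m) : R :=
  set_min [set nu (zeta_plus xilo xihi p M) 0 p +
               dot M (zeta_minus xilo xihi p M - zeta_plus xilo xihi p M)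
          | M in Mc p].

Definition nu_lower (xilo xihi : 'rV[R]_n) (p : 'I_m) : R :=
  set_max [set nu (zeta_minus xilo xihi p M) 0 p +
               dot M (zeta_plus xilo xihi p M - zeta_minus xilo xihi p M)
          | M in Mc p].

End BoundingFunction.

(* Big-step semantics: [while_loop c f s s'] holds when the loop with guard c
   and body f, started in s, terminates in s'. *)
Inductive while_loop {S : Type} (c : S -> bool) (f : S -> S) : S -> S -> Prop :=
| while_stop s : ~~ c s -> while_loop c f s s
| while_step s s' : c s -> while_loop c f (f s) s' -> while_loop c f s s'.

Inductive for_loop {I S : Type} (body : I -> S -> S -> Prop) :
    seq I -> S -> S -> Prop :=
| for_nil s : for_loop body [::] s s
| for_cons i r s s' s'' :
    body i s s' -> for_loop body r s' s'' -> for_loop body (i :: r) s s''.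

Section SetInv.
Context {R : realType} {n m : nat}.
Variables (nu : 'rV[R]_n -> 'rV[R]_m) (a b : 'I_m -> 'I_n -> \bar R).
Variables (ylo yhi : 'rV[R]_m) (eps : R).

Definition infeasible (xilo xihi : 'rV[R]_n) : Prop :=
  exists p, nu_upper nu a b xilo xihi p < ylo 0 p \/
            nu_lower nu a b xilo xihi p > yhi 0 p.

Record loop_state := LoopState {
  zlo : R;
  zhi : R;
  xlo : 'rV[R]_n;
  xhi : 'rV[R]_n }.

Definition guard (s : loop_state) : bool := zhi s - zlo s > eps.

Definition bodyA (i : 'I_n) (s : loop_state) : loop_state :=
  let zm := 2^-1 * (zlo s + zhi s) in
  if `[< infeasible (set_coord (xlo s) i zm) (xhi s) >]
  then LoopState (zlo s) zm (xlo s) (set_coord (xhi s) i zm)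
  else LoopState zm (zhi s) (xlo s) (xhi s).

Definition bodyB (i : 'I_n) (s : loop_state) : loop_state :=
  let zm := 2^-1 * (zlo s + zhi s) in
  if `[< infeasible (xlo s) (set_coord (xhi s) i zm) >]
  then LoopState zm (zhi s) (set_coord (xlo s) i zm) (xhi s)
  else LoopState (zlo s) zm (xlo s) (xhi s).

Definition loop_init (i : 'I_n) (x : 'rV[R]_n * 'rV[R]_n) : loop_state :=
  LoopState (x.1 0 i) (x.2 0 i) x.1 x.2.

Definition refine_loop (body : 'I_n -> loop_state -> loop_state) (i : 'I_n)
    (x x' : 'rV[R]_n * 'rV[R]_n) : Prop :=
  exists s, while_loop guard (body i) (loop_init i x) s /\
            x' = (xlo s, xhi s).

Definition refine_coord (i : 'I_n) (x x'' : 'rV[R]_n * 'rV[R]_n) : Prop :=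
  exists x', refine_loop bodyA i x x' /\ refine_loop bodyB i x' x''.

(* [set_inv xplo xphi xulo xuhi]: the algorithm run on the prior interval with
   endpoints xplo, xphi terminates and returns the endpoints xulo, xuhi.
   [enum 'I_n] lists the coordinates in increasing order. *)
Definition set_inv (xplo xphi xulo xuhi : 'rV[R]_n) : Prop :=
  for_loop refine_coord (enum 'I_n) (xplo, xphi) (xulo, xuhi).

End SetInv.

(* Main.v *)
(* A one-sided bound on the Clarke difference quotients at every point of a
   segment of X parallel to e_q integrates to the corresponding linear bound on
   the increment of nu_p along the segment; no continuity is needed.  Going from
   a corner zeta of a box to a point x of the box one coordinate at a time, each
   entry of M is a sign-corrected bound on the increment, so nu_p x lies between
   the values defining nu_lower and nu_upper.  Hence an infeasible box contains
   no feasible point, and the half discarded by a bisection step contains none.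
   The search interval is halved at each step, so the loops terminate. *)
Require Import Defs.
From mathcomp Require Import all_boot all_order all_algebra.
From mathcomp Require Import all_classical all_reals all_analysis.
From mathcomp Require Import lra ring.

Set Implicit Arguments.
Unset Strict Implicit.
Unset Printing Implicit Defensive.

Import Order.TTheory GRing.Theory Num.Theory.
Import numFieldNormedType.Exports.

Local Open Scope classical_set_scope.
Local Open Scope ring_scope.

(** * From local to global slope bounds on a real interval *)

(** The local hypothesis bounds separately the distance of [y] from [x] and the step [z - y],
    matching the product filter behind the Clarke quotients. *)
Lemma local_slope_le (R : realType) (g : R -> R) (c s t : R) : s <= t ->
  (forall x, s <= x <= t -> exists2 d, 0 < d &
     forall y z, s <= y -> y <= z -> z <= t -> `|y - x| < d -> z - y < d ->
       g z - g y <= c * (z - y)) ->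
  g t - g s <= c * (t - s).
Proof.
move=> st loc.
(* The supremum of A is attained, and cannot be smaller than t. *)
pose A : set R := [set v | s <= v <= t /\ g v - g s <= c * (v - s)].
have As : A s by split; [rewrite lexx st | rewrite !subrr mulr0].
have supA : has_sup A by split; [exists s | exists t => v [] /andP[]].
have s_le : s <= sup A by apply: ub_le_sup supA.2 _ _.
have le_t : sup A <= t by apply: ge_sup; [exists s | move=> v [] /andP[]].
have [|d d0 slope] := loc (sup A); first by rewrite s_le le_t.
have d20 : 0 < d / 2 by lra.
have [v [/andP[sv vt] gv]] := sup_adherent d20 supA.
have vA : v <= sup A by apply: ub_le_sup supA.2 _ _; split => //; rewrite sv vt.
move=> vd.
have step w : v <= w -> w <= t -> w - v < d -> A w.
  move=> vw wt wd; split; first by rewrite (le_trans sv vw) wt.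
  have : g w - g v <= c * (w - v).
    by apply: slope => //; rewrite ler0_norm; lra.
  have -> : c * (w - v) = c * (w - s) - c * (v - s) by ring.
  lra.
have [t_le|lt_t] := leP t (sup A); first by case: (step t) => //; lra.
(* Since [v] is within [d / 2] of the supremum, [w - v] stays below [3 d / 4], so [w] would be a
   member of [A] beyond [sup A]. *)
pose w := Num.min (sup A + d / 4) t.
have w_le : w <= sup A + d / 4 by rewrite ge_min lexx.
have w_t : w <= t by rewrite ge_min lexx orbT.
have w_gt : sup A < w by rewrite lt_min lt_t andbT; lra.
have /(ub_le_sup supA.2) : A w by apply: step => //; lra.
by rewrite leNgt w_gt.
Qed.

(** * Moving one coordinate at a time *)

Section Coordinates.
Context {R : realType} {n : nat}.
Implicit Types (x w lo hi : 'rV[R]_n) (q : 'I_n).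

Lemma set_coordE x q c k : set_coord x q c 0 k = if k == q then c else x 0 k.
Proof. by rewrite mxE. Qed.

Lemma set_coord_shift x q c d :
  set_coord x q (c + d) = set_coord x q c + d *: unit_vec q.
Proof.
apply/rowP => k; rewrite !mxE eqxx /=.
by case: eqVneq => _; rewrite ?mulr1 ?mulr0 ?addr0.
Qed.

Lemma set_coord_ball x q c c' e :
  `|c - c'| < e -> ball (set_coord x q c) e (set_coord x q c').
Proof.
move=> ce; have e0 : 0 < e by apply: le_lt_trans ce.
split=> // i j; rewrite !ord1 !set_coordE; case: eqP => _ //.
exact: ballxx.
Qed.

(** Telescoping: the coordinates of [z] are replaced by those of [x] one by one. Each intermediate
    point mixes coordinates of [x] and [z], hence stays in the box. *)
Lemma path_le (f : 'rV[R]_n -> R) lo hi (d : 'I_n -> R) x z :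
  box_between lo hi x -> box_between lo hi z ->
  (forall w q, box_between lo hi w ->
     f (set_coord w q (x 0 q)) <= f (set_coord w q (z 0 q)) + d q) ->
  f x <= f z + \sum_q d q.
Proof.
move=> bx bz step.
pose w (r : seq 'I_n) : 'rV[R]_n := \row_q (if q \in r then x 0 q else z 0 q).
have bw r : box_between lo hi (w r).
  by move=> q; rewrite mxE; case: ifP => _; [exact: bx | exact: bz].
have main r : uniq r -> f (w r) <= f z + \sum_(q <- r) d q.
  elim: r => [_|q r IH /=/andP[qr /IH wr]].
    have -> : w [::] = z by apply/rowP => k; rewrite mxE.
    by rewrite big_nil addr0.
  have -> : w (q :: r) = set_coord (w r) q (x 0 q).
    apply/rowP => k; rewrite !mxE in_cons.
    by case: eqVneq => [->|].
  apply: le_trans (step _ _ (bw r)) _.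
  have -> : set_coord (w r) q (z 0 q) = w r.
    apply/rowP => k; rewrite !mxE.
    by case: eqVneq => [->|//]; rewrite (negbTE qr).
  by rewrite big_cons; lra.
have -> : x = w (index_enum 'I_n).
  by apply/rowP => k; rewrite mxE mem_index_enum.
exact: main (index_enum_uniq _).
Qed.

End Coordinates.

(** * Clarke quotients and increments along axis-parallel segments *)

Section Slopes.
Context {R : realType} {n : nat}.
Implicit Types (X : set 'rV[R]_n) (f : 'rV[R]_n -> R) (q : 'I_n).

(** A strict bound on the limsup is witnessed by a single set of the filter; one radius [d] then
    serves both the base point and the step. *)
Lemma limsup_quotient_lt X f q x (c : R) :
  (limf_esup (fun tl : 'rV[R]_n * R =>
       ((f (tl.1 + tl.2 *: unit_vec q) - f tl.1) / tl.2)%:E)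
     (clarke_filter X x q) < c%:E)%E ->
  exists2 d, 0 < d & forall y l, 0 < l < d -> ball x d y ->
    X y -> X (y + l *: unit_vec q) ->
    f (y + l *: unit_vec q) - f y <= c * l.
Proof.
move=> /ereal_inf_lt[_ [V FV <-]] Vc.
have [[P Q] [/= /nbhs_ballP[d1 /= d10 P1] [d2 /= d20 Q2]] PQV] := FV.
exists (Num.min d1 d2); first by rewrite lt_min d10 d20.
move=> y l /andP[l0]; rewrite lt_min => /andP[ld1 ld2] xy Xy Xyl.
have Vyl : V (y, l).
  apply: (PQV (y, l)); last by [].
  split => /=.
    by apply: P1; apply: le_ball xy; rewrite ge_min lexx.
  by apply: Q2; rewrite //= sub0r normrN gtr0_norm.
rewrite -ler_pdivrMr // -lee_fin; apply: le_trans (ltW Vc).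
by apply: ereal_sup_ubound; exists (y, l).
Qed.

(** The slack [e] makes the limsup bound strict, so that the local estimate applies; it is removed
    at the end by letting [e] tend to 0. *)
Lemma limsup_quotient_le X f q (c : R) :
  (forall x, X x -> (limf_esup (fun tl : 'rV[R]_n * R =>
       ((f (tl.1 + tl.2 *: unit_vec q) - f tl.1) / tl.2)%:E)
     (clarke_filter X x q) <= c%:E)%E) ->
  forall w s t, s <= t -> (forall r, s <= r <= t -> X (set_coord w q r)) ->
  f (set_coord w q t) - f (set_coord w q s) <= c * (t - s).
Proof.
move=> fc w s t st Xw.
have cE e : 0 < e ->
    f (set_coord w q t) - f (set_coord w q s) <= (c + e) * (t - s).
  move=> e0; apply: (local_slope_le (g := fun r => f (set_coord w q r))) => //.
  move=> x sxt; have [|d d0 slope] := @limsup_quotient_lt X f q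
      (set_coord w q x) (c + e).
    by apply: le_lt_trans (fc _ (Xw _ sxt)) _; rewrite lte_fin ltrDl.
  exists d => // y z sy yz zt yx zy.
  have [->|yDz] := eqVneq y z; first by rewrite !subrr mulr0.
  have zE : set_coord w q z = set_coord w q y + (z - y) *: unit_vec q.
    by rewrite -set_coord_shift addrC subrK.
  rewrite zE; apply: slope.
  - by rewrite zy subr_gt0 lt_neqAle yDz yz.
  - by apply: set_coord_ball; rewrite distrC.
  - by apply: Xw; rewrite sy (le_trans yz zt).
  - by rewrite -zE; apply: Xw; rewrite zt (le_trans sy yz).
have [->|sDt] := eqVneq s t; first by rewrite !subrr mulr0.
have st0 : 0 < t - s by rewrite subr_gt0 lt_neqAle sDt st.
rewrite -ler_pdivrMr //; apply/ler_addgt0Pr => e e0.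
by rewrite ler_pdivrMr //; exact: cE.
Qed.

Lemma liminf_quotient_ge X f q (c : R) :
  (forall x, X x -> (c%:E <= limf_einf (fun tl : 'rV[R]_n * R =>
       ((f (tl.1 + tl.2 *: unit_vec q) - f tl.1) / tl.2)%:E)
     (clarke_filter X x q))%E) ->
  forall w s t, s <= t -> (forall r, s <= r <= t -> X (set_coord w q r)) ->
  c * (t - s) <= f (set_coord w q t) - f (set_coord w q s).
Proof.
move=> fc w s t st Xw.
have := @limsup_quotient_le X (fun x => - f x) q (- c) _ w s t st Xw.
have Nfc x : X x -> (limf_esup (fun tl : 'rV[R]_n * R =>
    ((- f (tl.1 + tl.2 *: unit_vec q) - - f tl.1) / tl.2)%:E)
    (clarke_filter X x q) <= (- c)%:E)%E.
  move=> /fc; rewrite EFinN leeNr /limf_einf.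
  set G := (X in limf_esup X _).
  set F := (X in _ -> is_true (limf_esup X _ <= _)%E).
  suff -> : F = G by [].
  by apply/funext => tl; rewrite /F /G /= -opprD mulNr.
by move=> /(_ Nfc); lra.
Qed.

End Slopes.

(** * Extrema of finite sets of values *)

(** [get] is meaningful only if a least element exists. Finiteness supplies one, so [set_min A]
    belongs to [A] and inherits the bound. *)
Lemma set_min_ge {R : realType} {T : finType} (g : T -> R) (A : set R) (c : R) :
  A !=set0 -> A `<=` range g -> (forall v, A v -> c <= v) -> c <= set_min A.
Proof.
move=> [v0 Av0] Ag cA.
have [i0 _ gi0] := Ag _ Av0.
have Pi0 : `[< A (g i0) >] by apply/asboolP; rewrite gi0.
have [i /asboolP Agi opt_i] :=
  @arg_minP _ _ _ i0 (fun i => `[< A (g i) >]) g Pi0.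
have opt : exists v : R, [set v | A v /\ lbound A v] v.
  exists (g i); split => // v Av; have [j _ gj] := Ag _ Av.
  by rewrite -gj; apply: opt_i; apply/asboolP; rewrite gj.
exact: cA _ (getPex opt).1.
Qed.

Lemma set_max_le {R : realType} {T : finType} (g : T -> R) (A : set R) (c : R) :
  A !=set0 -> A `<=` range g -> (forall v, A v -> v <= c) -> set_max A <= c.
Proof.
move=> [v0 Av0] Ag cA.
have [i0 _ gi0] := Ag _ Av0.
have Pi0 : `[< A (g i0) >] by apply/asboolP; rewrite gi0.
have [i /asboolP Agi opt_i] :=
  @arg_maxP _ _ _ i0 (fun i => `[< A (g i) >]) g Pi0.
have opt : exists v : R, [set v | A v /\ ubound A v] v.
  exists (g i); split => // v Av; have [j _ gj] := Ag _ Av.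
  by rewrite -gj; apply: opt_i; apply/asboolP; rewrite gj.
exact: cA _ (getPex opt).1.
Qed.

(** * The corner values bound the function on a box *)

Section Bounding.
Context {R : realType} {n m : nat}.
Variables (X : set 'rV[R]_n) (nu : 'rV[R]_n -> 'rV[R]_m).
Variables (a b : 'I_m -> 'I_n -> \bar R).
Hypothesis hab : clarke_bounds X nu a b.

Lemma Mc_nonempty p : Mc a b p !=set0.
Proof.
exists (\row_q if b p q == +oo%E then fine (mine (a p q) 0)
               else fine (maxe (b p q) 0)) => q.
rewrite mxE; have [aoo boo ab _] := hab p q.
(* The two bounds are never both infinite: where [b] is infinite, [a] is finite. *)
case: eqP => [bE|bE].
  right; rewrite fineK //; case: (a p q) aoo ab => [r| |] // _ ab.
    by rewrite -EFin_min.
  by case: ab.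
by left; rewrite fineK //; case: (b p q) boo bE => [r| |] //; rewrite -EFin_max.
Qed.

(** One bit per coordinate records which alternative holds. The default value of [fine] is never met
    on [Mc], whose entries are real. *)
Lemma Mc_finite p : exists g : {ffun 'I_n -> bool} -> 'rV[R]_n,
  Mc a b p `<=` range g.
Proof.
exists (fun h => \row_q fine (if h q then maxe (b p q) 0 else mine (a p q) 0)).
move=> M McM; exists [ffun q => (M 0 q)%:E == maxe (b p q) 0] => //.
apply/rowP => q; rewrite mxE ffunE.
by case: eqP => [<-//|?]; case: (McM q) => // <-.
Qed.

Variables (lo hi x : 'rV[R]_n).
Hypotheses (loX : box_between lo hi `<=` X) (lox : box_between lo hi x).

Lemma set_coord_box w q r : box_between lo hi w -> lo 0 q <= r <= hi 0 q ->
  X (set_coord w q r).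
Proof.
move=> bw /andP[lr rh]; apply: loX => k; rewrite set_coordE.
by case: eqVneq => [->|].
Qed.

Lemma zeta_plus_box p (M : 'rV[R]_n) : box_between lo hi (zeta_plus a lo hi p M).
Proof.
move=> q; rewrite mxE; have [lq qh] := lox q.
by case: ifP; rewrite lexx (le_trans lq qh).
Qed.

Lemma zeta_minus_box p (M : 'rV[R]_n) : box_between lo hi (zeta_minus a lo hi p M).
Proof.
move=> q; rewrite mxE; have [lq qh] := lox q.
by case: ifP; rewrite lexx (le_trans lq qh).
Qed.

Lemma nu_coord_ge p (M : 'rV[R]_n) q w s t : (M 0 q)%:E = mine (a p q) 0 ->
  box_between lo hi w -> lo 0 q <= s -> s <= t -> t <= hi 0 q ->
  M 0 q * (t - s) <= nu (set_coord w q t) 0 p - nu (set_coord w q s) 0 p.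
Proof.
move=> ME bw ls st th; have [aoo _ _ clarke] := hab p q.
case aE : (a p q) aoo ME clarke => [c|//|] _; last by rewrite minNye.
rewrite -EFin_min => -[ME] clarke.
have Mc : M 0 q <= c by rewrite ME ge_min lexx.
have Xw r : s <= r <= t -> X (set_coord w q r).
  move=> /andP[sr rt]; apply: set_coord_box => //.
  by rewrite (le_trans ls sr) (le_trans rt th).
have := liminf_quotient_ge (f := fun x => nu x 0 p)
  (fun x Xx => (clarke x Xx).1) st Xw.
by apply: le_trans; rewrite ler_wpM2r // subr_ge0.
Qed.

Lemma nu_coord_le p (M : 'rV[R]_n) q w s t : (M 0 q)%:E = maxe (b p q) 0 ->
  box_between lo hi w -> lo 0 q <= s -> s <= t -> t <= hi 0 q ->
  nu (set_coord w q t) 0 p - nu (set_coord w q s) 0 p <= M 0 q * (t - s).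
Proof.
move=> ME bw ls st th; have [_ boo _ clarke] := hab p q.
case bE : (b p q) boo ME clarke => [c||//] _; last by rewrite maxye.
rewrite -EFin_max => -[ME] clarke.
have Mc : c <= M 0 q by rewrite ME le_max lexx.
have Xw r : s <= r <= t -> X (set_coord w q r).
  move=> /andP[sr rt]; apply: set_coord_box => //.
  by rewrite (le_trans ls sr) (le_trans rt th).
apply: le_trans (limsup_quotient_le (f := fun x => nu x 0 p)
  (fun x Xx => (clarke x Xx).2) st Xw) _.
by rewrite ler_wpM2r // subr_ge0.
Qed.

(** Ties go to the [mine] case, in agreement with the test defining the corners. *)
Lemma McP p (M : 'rV[R]_n) q : Mc a b p M ->
  ((M 0 q)%:E = mine (a p q) 0 /\ M 0 q <= 0) \/
  [/\ (M 0 q)%:E <> mine (a p q) 0, (M 0 q)%:E = maxe (b p q) 0 & 0 <= M 0 q].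
Proof.
move=> /(_ q) ME; have [Ma|Ma] := eqVneq (M 0 q)%:E (mine (a p q) 0).
  by left; split=> //; rewrite -lee_fin Ma ge_min lexx orbT.
right; have Mb : (M 0 q)%:E = maxe (b p q) 0.
  by case: ME => // /eqP; rewrite (negbTE Ma).
by split=> //; [exact/eqP | rewrite -lee_fin Mb le_max lexx orbT].
Qed.

(** If [M 0 q <= 0], going from [hi] to [x] adds at most [M (x - hi) <= M (lo - hi)]; otherwise
    going from [lo] to [x] adds at most [M (x - lo) <= M (hi - lo)]. *)
Lemma nu_le_corner p (M : 'rV[R]_n) : Mc a b p M ->
  nu x 0 p <= nu (zeta_plus a lo hi p M) 0 p +
     dot M (zeta_minus a lo hi p M - zeta_plus a lo hi p M).
Proof.
move=> McM; apply: (path_le (f := fun x => nu x 0 p) lox (zeta_plus_box p M)).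
move=> w q bw; have [lq qh] := lox q; rewrite !mxE.
have [[Ma M0]|[/eqP/negbTE Ma Mb M0]] := McP q McM.
  rewrite Ma eqxx; have := nu_coord_ge Ma bw lq qh (lexx _); nra.
rewrite Ma; have := nu_coord_le Mb bw (lexx _) lq qh; nra.
Qed.

(** The same path argument for the negated function, started at the opposite corner. *)
Lemma nu_ge_corner p (M : 'rV[R]_n) : Mc a b p M ->
  nu (zeta_minus a lo hi p M) 0 p +
     dot M (zeta_plus a lo hi p M - zeta_minus a lo hi p M) <= nu x 0 p.
Proof.
move=> McM; rewrite -lerN2 opprD /dot -sumrN.
apply: (path_le (f := fun x => - nu x 0 p) lox (zeta_minus_box p M)).
move=> w q bw; have [lq qh] := lox q; rewrite !mxE.
have [[Ma M0]|[/eqP/negbTE Ma Mb M0]] := McP q McM.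
  rewrite Ma eqxx; have := nu_coord_ge Ma bw (lexx _) lq qh; nra.
rewrite Ma; have := nu_coord_le Mb bw lq qh (lexx _); nra.
Qed.

Lemma nu_upper_ge p : nu x 0 p <= nu_upper nu a b lo hi p.
Proof.
have [g Mg] := Mc_finite p; have [M0 McM0] := Mc_nonempty p.
pose value (M : 'rV[R]_n) := nu (zeta_plus a lo hi p M) 0 p +
  dot M (zeta_minus a lo hi p M - zeta_plus a lo hi p M).
apply: (set_min_ge (g := value \o g)).
- by exists (value M0), M0.
- by move=> _ [M /Mg[h _ <-] <-]; exists h.
- by move=> _ [M McM <-]; exact: nu_le_corner.
Qed.

Lemma nu_lower_le p : nu_lower nu a b lo hi p <= nu x 0 p.
Proof.
have [g Mg] := Mc_finite p; have [M0 McM0] := Mc_nonempty p.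
pose value (M : 'rV[R]_n) := nu (zeta_minus a lo hi p M) 0 p +
  dot M (zeta_plus a lo hi p M - zeta_minus a lo hi p M).
apply: (set_max_le (g := value \o g)).
- by exists (value M0), M0.
- by move=> _ [M /Mg[h _ <-] <-]; exists h.
- by move=> _ [M McM <-]; exact: nu_ge_corner.
Qed.

Lemma feasible_point ylo yhi :
  box_between ylo yhi (nu x) -> ~ infeasible nu a b ylo yhi lo hi.
Proof.
move=> yx [p]; have [yl yh] := yx p.
have := nu_upper_ge p; have := nu_lower_le p.
by move=> ? ? [?|?]; lra.
Qed.

End Bounding.

(** * Invariants and totality of loops *)

Lemma while_loop_inv {S : Type} (c : S -> bool) (f : S -> S) (P : S -> Prop) :
  (forall s, c s -> P s -> P (f s)) ->
  forall s s', while_loop c f s s' -> P s -> P s'.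
Proof.
move=> Pf s s'; elim=> // {}s {}s' cs _ IH Ps.
by apply: IH; apply: Pf.
Qed.

Lemma for_loop_inv {I S : Type} (body : I -> S -> S -> Prop) (P : S -> Prop) :
  (forall i s s', body i s s' -> P s -> P s') ->
  forall r s s', for_loop body r s s' -> P s -> P s'.
Proof.
move=> Pb r s s'; elim=> // i {}r {}s s1 {}s' bs _ IH Ps.
by apply: IH; apply: Pb bs Ps.
Qed.

Lemma for_loop_total {I S : Type} (body : I -> S -> S -> Prop) :
  (forall i s, exists s', body i s s') ->
  forall r s, exists s', for_loop body r s s'.
Proof.
move=> tot; elim=> [|i r IH] s; first by exists s; exact: for_nil.
have [s1 bs] := tot i s; have [s2 rs] := IH s1.
by exists s2; exact: for_cons bs rs.
Qed.

(** * Termination and correctness of the set inversion algorithm *)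

Section Algorithm.
Context {R : realType} {n m : nat}.
Variables (nu : 'rV[R]_n -> 'rV[R]_m) (a b : 'I_m -> 'I_n -> \bar R).
Variables (ylo yhi : 'rV[R]_m) (eps : R).
Implicit Types (s : loop_state (R := R) (n := n)) (i : 'I_n).

Lemma halving_terminates (f : loop_state -> loop_state) :
  0 < eps ->
  (forall s, zhi (f s) - zlo (f s) = (zhi s - zlo s) / 2) ->
  forall s, exists s', while_loop (guard eps) f s s'.
Proof.
move=> eps0 halve.
have main k s : zhi s - zlo s <= eps * 2 ^+ k ->
    exists s', while_loop (guard eps) f s s'.
  elim: k s => [|k IH] s sk.
    by exists s; apply: while_stop; rewrite /guard -leNgt -[eps]mulr1.
  have [cs|ncs] := boolP (guard eps s); last by exists s; exact: while_stop.
  have [|s' fs] := IH (f s); last by exists s'; exact: while_step fs.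
  by rewrite halve ler_pdivrMr // -mulrA -exprSr.
(* An integer [k] above the ratio of width to threshold is enough, since [k < 2 ^ k]. *)
move=> s; have := archi_boundP (normr_ge0 ((zhi s - zlo s) / eps)).
set k := Num.bound _ => wk; apply: (main k).
rewrite -ler_pdivrMl // mulrC; apply: le_trans (ler_norm _) _.
apply: le_trans (ltW wk) _; rewrite -natrX ler_nat.
exact: ltnW (ltn_expl _ _).
Qed.

Lemma bodyA_halve i s :
  zhi (bodyA nu a b ylo yhi i s) - zlo (bodyA nu a b ylo yhi i s) =
  (zhi s - zlo s) / 2.
Proof. by rewrite /bodyA; case: asboolP => _ /=; field. Qed.

Lemma bodyB_halve i s :
  zhi (bodyB nu a b ylo yhi i s) - zlo (bodyB nu a b ylo yhi i s) =
  (zhi s - zlo s) / 2.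
Proof. by rewrite /bodyB; case: asboolP => _ /=; field. Qed.

Lemma set_inv_total (xplo xphi : 'rV[R]_n) : 0 < eps ->
  exists xulo xuhi, set_inv nu a b ylo yhi eps xplo xphi xulo xuhi.
Proof.
move=> eps0.
have tot i x : exists x'', refine_coord nu a b ylo yhi eps i x x''.
  have [sA runA] := halving_terminates eps0 (bodyA_halve i) (loop_init i x).
  have [sB runB] := halving_terminates eps0 (bodyB_halve i)
    (loop_init i (xlo sA, xhi sA)).
  exists (xlo sB, xhi sB), (xlo sA, xhi sA).
  by split; [exists sA | exists sB].
have [[xulo xuhi] run] := for_loop_total tot (enum 'I_n) (xplo, xphi).
by exists xulo, xuhi.
Qed.

Variables (X : set 'rV[R]_n) (xplo xphi : 'rV[R]_n).
Hypotheses (hab : clarke_bounds X nu a b) (hXp : box_between xplo xphi `<=` X).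
Hypothesis eps_ge0 : 0 <= eps.

Definition feasible : set 'rV[R]_n :=
  [set x | box_between xplo xphi x /\ box_between ylo yhi (nu x)].

(* The endpoint inequalities, rather than the inclusion of boxes, survive when
   the prior box is empty. *)
Definition enclosure (x : 'rV[R]_n * 'rV[R]_n) : Prop :=
  feasible `<=` box_between x.1 x.2 /\
  forall q, xplo 0 q <= x.1 0 q /\ x.2 0 q <= xphi 0 q.

(** The search interval stays within side [i] of the current box, so a midpoint used as a new
    endpoint never leaves the prior bounds. *)
Definition loop_inv i s : Prop :=
  [/\ enclosure (xlo s, xhi s), xlo s 0 i <= zlo s & zhi s <= xhi s 0 i].

Lemma feasible_outside (lo hi : 'rV[R]_n) x :
  (forall q, xplo 0 q <= lo 0 q /\ hi 0 q <= xphi 0 q) ->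
  infeasible nu a b ylo yhi lo hi -> feasible x -> ~ box_between lo hi x.
Proof.
move=> sub inf [_ yx] bx; apply: (feasible_point hab _ bx yx inf).
move=> y by_; apply: hXp => q; have [h1 h2] := sub q; have [h3 h4] := by_ q.
by rewrite (le_trans h1 h3) (le_trans h4 h2).
Qed.

Lemma bodyA_inv i s : guard eps s -> loop_inv i s ->
  loop_inv i (bodyA nu a b ylo yhi i s).
Proof.
rewrite /guard /bodyA => gs [[/= feas sub] lo_z z_hi].
have zz : zlo s < zhi s by have := eps_ge0; lra.
have [xplo_i xphi_i] := sub i.
set zm := 2^-1 * _; have zm_lo : zlo s < zm by rewrite /zm; lra.
have zm_hi : zm < zhi s by rewrite /zm; lra.
case: asboolP => [inf|_]; last by split=> //=; lra.
split=> //=; last by rewrite set_coordE eqxx.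
split => /= [x Fx q|q]; rewrite set_coordE; last first.
  by have [? ?] := sub q; split=> //; case: eqP => [->|//]; lra.
have [lq qh] := feas x Fx q; split=> //; case: eqP => // qi; subst q.
(* A feasible point with coordinate above [zm] would lie in the upper part just found infeasible. *)
rewrite leNgt; apply/negP => zx; apply: (feasible_outside _ inf Fx) => q.
  rewrite set_coordE; have [? ?] := sub q.
  by split=> //; case: eqP => [->|//]; lra.
rewrite set_coordE; have [? ?] := feas x Fx q.
by split=> //; case: eqP => [->|//]; lra.
Qed.

Lemma bodyB_inv i s : guard eps s -> loop_inv i s ->
  loop_inv i (bodyB nu a b ylo yhi i s).
Proof.
rewrite /guard /bodyB => gs [[/= feas sub] lo_z z_hi].
have zz : zlo s < zhi s by have := eps_ge0; lra.
have [xplo_i xphi_i] := sub i.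
set zm := 2^-1 * _; have zm_lo : zlo s < zm by rewrite /zm; lra.
have zm_hi : zm < zhi s by rewrite /zm; lra.
case: asboolP => [inf|_]; last by split=> //=; lra.
split=> //=; last by rewrite set_coordE eqxx.
split => /= [x Fx q|q]; rewrite set_coordE; last first.
  by have [? ?] := sub q; split=> //; case: eqP => [->|//]; lra.
have [lq qh] := feas x Fx q; split=> //; case: eqP => // qi; subst q.
(* Here the lower part is the infeasible one. *)
rewrite leNgt; apply/negP => zx; apply: (feasible_outside _ inf Fx) => q.
  rewrite set_coordE; have [? ?] := sub q.
  by split=> //; case: eqP => [->|//]; lra.
rewrite set_coordE; have [? ?] := feas x Fx q.
by split=> //; case: eqP => [->|//]; lra.
Qed.

Lemma set_inv_enclosure (xulo xuhi : 'rV[R]_n) :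
  set_inv nu a b ylo yhi eps xplo xphi xulo xuhi -> enclosure (xulo, xuhi).
Proof.
move=> run; apply: for_loop_inv run _; last by split=> [x []|q].
move=> i x x'' [x' [[sA [runA ->]] [sB [runB ->]]]] encl.
have init y : enclosure y -> loop_inv i (loop_init i y).
  by case: y => y1 y2 ency; split; rewrite //= lexx.
have [enclA _ _] := while_loop_inv (@bodyA_inv i) runA (init _ encl).
by have [] := while_loop_inv (@bodyB_inv i) runB (init _ enclA).
Qed.

End Algorithm.

Theorem proposition11 (R : realType) (nx ny nu_dim : nat)
    (X : set 'rV[R]_nx) (hX : is_box X)
    (mu : 'rV[R]_nx -> 'rV[R]_nu_dim -> 'rV[R]_ny) (u : 'rV[R]_nu_dim)
    (nu : 'rV[R]_nx -> 'rV[R]_ny) (hnu : forall x, X x -> nu x = mu x u)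
    (hELLC : ELLC_vec X nu)
    (a b : 'I_ny -> 'I_nx -> \bar R) (hab : clarke_bounds X nu a b)
    (Y : set 'rV[R]_ny) (ylo yhi : 'rV[R]_ny) (hY : Y `<=` box_between ylo yhi)
    (xplo xphi : 'rV[R]_nx) (hXp : box_between xplo xphi `<=` X)
    (eps : R) (heps : 0 < eps) :
  (exists xulo xuhi : 'rV[R]_nx,
      set_inv nu a b ylo yhi eps xplo xphi xulo xuhi) /\
  (forall xulo xuhi : 'rV[R]_nx,
      set_inv nu a b ylo yhi eps xplo xphi xulo xuhi ->
      [set x | box_between xplo xphi x /\ box_between ylo yhi (mu x u)]
        `<=` box_between xulo xuhi /\
      box_between xulo xuhi `<=` box_between xplo xphi).
Proof.
split=> [|xulo xuhi run]; first exact: set_inv_total.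
have [feas sub] := set_inv_enclosure hab hXp (ltW heps) run.
split=> [x [px yx]|x ux q].
  (* [nu] and [mu] at [u] agree on the prior box because it lies in [X]. *)
  by apply: feas; split=> //; rewrite hnu //; exact: hXp.
have [h1 h2] := sub q; have [h3 h4] := ux q.
by rewrite (le_trans h1 h3) (le_trans h4 h2).
Qed.
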